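(* Let $K:\mathbb{R}\to\mathbb{R}$, $\omega_2:\mathbb{R}^+\times\mathbb{R}^+\to\mathbb{R}$, $Q:\mathbb{R}^+\to\mathbb{R}^+$, where $\mathbb{R}^+=[0,+\infty)$, satisfy the following conditions. 1) $K(x)>0$ for $x\in\mathbb{R}$; $K(-t)=K(t)$ for $t\in\mathbb{R}^+$; $K$ is continuously differentiable on $\mathbb{R}$, and $K$ and $K'$ are bounded on $\mathbb{R}$. 2) $K$ monotonically decreases on $\mathbb{R}^+$ and $\int_0^\infty K(t)\,dt=\frac12$. 3) $\int_0^\infty xK(x)\,dx<+\infty$. 0) $Q(0)=0$ and $\omega_2(t,0)=0$ for all $t\in\mathbb{R}^+$. $b_1$) $\omega_2$ is continuous on $\mathbb{R}^+\times\mathbb{R}^+$ and, for each fixed $t\in\mathbb{R}^+$, the function $u\mapsto\omega_2(t,u)$ increases monotonically on $\mathbb{R}^+$ and is concave on $\mathbb{R}^+$. $b_2$) There exists a positive function $\mu_2$, summable on $\mathbb{R}^+$ and with zero limit at infinity, such that $\omega_2(t,u)\le\mu_2(t)u$ for all $t,u\in\mathbb{R}^+$. I) $Q$ is continuous and increases monotonically on $\mathbb{R}^+$. II) $Q$ is convex on $\mathbb{R}^+$ and there exists a number $\xi>0$ such that $Q(\xi)=(1+M)\xi$, where $M:=\int_0^\infty\mu_2(t)\,dt\cdot\sup_{x\in\mathbb{R}}K(x)$. III) There exists a continuous, monotonically increasing and concave map $\varphi:[0,1]\to[0,1]$ with $\varphi(0)=0$ and $\varphi(1)=1$ such that $G(\sigma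 u)\ge\varphi(\sigma)G(u)$ for all $\sigma\in(0,1)$ and $u\in(0,(1+M)\xi)$, where $G$ is the inverse function of $Q$ on $\mathbb{R}^+$. Then the integral equation $$Q(B(x))=\int_0^\infty\big(K(x-t)-K(x+t)\big)\big(B(t)+\omega_2(t,B(t))\big)\,dt,\qquad x\in\mathbb{R}^+,$$ has only one solution in the class of functions $$\mathfrak{M}:=\Big\{B\in M(\mathbb{R}^+):\ B(x)\ge0\ \text{for } x\in\mathbb{R}^+,\ \text{and there exists } r>0 \text{ such that } \inf_{x>r}B(x)>0\Big\}.$$
   Context: $\mathbb{R}^+:=[0,+\infty)$. $M(\mathbb{R}^+)$ is the space of bounded functions on $\mathbb{R}^+$ (not to be confused with the number $M$ in condition II)).
   Formalization: The map φ in III is additionally required not to be the identity: for φ(σ)=σ condition III is automatic and the claim fails, e.g. Q(u)=(1+M)u, ω₂=0 has no solution in 𝔐. Also μ₂ is taken Borel measurable, which loses nothing after a change on a null set. *)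

(* Defs.v *)
From HB Require Import structures.
From mathcomp Require Export all_boot all_order all_algebra.
From mathcomp Require Export all_classical all_reals all_analysis.

Set Implicit Arguments.
Unset Strict Implicit.
Unset Printing Implicit Defensive.

Import Order.TTheory GRing.Theory Num.Theory.
Import numFieldNormedType.Exports.

Local Open Scope classical_set_scope.
Local Open Scope ring_scope.

(* A function on the half-line is represented by a total function on R of which
   only the values at nonnegative arguments are ever constrained or used. *)
Definition Rplus (R : realType) : set R := `[0, +oo[.
Arguments Rplus : clear implicits.

Definition unit_itv (R : realType) : set R := `[0, 1].
Arguments unit_itv : clear implicits.

Definition convex_on (R : realType) (D : set R) (f : R -> R) : Prop :=
  convex_function (D : set R^o) f.

Definition concave_on (R : realType) (D : set R) (f : R -> R) : Prop :=
  convex_on D (fun x => - f x).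

Definition nondecreasing_on (R : realType) (D : set R) (f : R -> R) : Prop :=
  {in D &, forall x y : R, x <= y -> f x <= f y}.

Definition nonincreasing_on (R : realType) (D : set R) (f : R -> R) : Prop :=
  {in D &, forall x y : R, x <= y -> f y <= f x}.

Definition inverse_on_Rplus (R : realType) (Q G : R -> R) : Prop :=
  forall u : R, 0 <= u -> [/\ 0 <= G u, G (Q u) = u & Q (G u) = u].

Definition Mconst (R : realType) (K mu2 : R -> R) : R :=
  (\int[lebesgue_measure]_(t in Rplus R) mu2 t) * sup (range K).

Definition integrand (R : realType) (K : R -> R) (omega2 : R -> R -> R)
    (B : R -> R) (x t : R) : R :=
  (K (x - t) - K (x + t)) * (B t + omega2 t (B t)).

(* The integral is total, with a junk value on non-integrable functions, so
   being a solution includes that the right-hand side is meaningful. *)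
Definition is_solution (R : realType) (K : R -> R) (omega2 : R -> R -> R)
    (Q B : R -> R) : Prop :=
  forall x : R, 0 <= x ->
    lebesgue_measure.-integrable (Rplus R) (EFin \o integrand K omega2 B x) /\
    Q (B x) = \int[lebesgue_measure]_(t in Rplus R) integrand K omega2 B x t.

Definition frakM (R : realType) : set (R -> R) :=
  [set B : R -> R | [/\ [bounded (B x : R^o) | x in Rplus R],
               forall x : R, 0 <= x -> 0 <= B x &
               exists2 r : R, 0 < r & 0 < inf (B @` `]r, +oo[)]].
Arguments frakM : clear implicits.

(* Main.v *)
Require Import Defs.
From mathcomp Require Import ring lra measurable_realfun.
Import Order.TTheory GRing.Theory Num.Theory.
Import numFieldNormedType.Exports.
Local Open Scope classical_set_scope.
Local Open Scope ring_scope.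

Set Implicit Arguments.
Unset Strict Implicit.
Unset Printing Implicit Defensive.

(** Write [k x t = K (x - t) - K (x + t)], which is nonnegative for [x, t >= 0],
    and [c = 1 + M]. The equation reads [Q \o B = A B] with
    [A B x = \int k x t * (B t + omega2 t (B t)) dt], that is, [B] is a fixed point of
    the monotone operator [G \o A].

    Everything about the kernel comes from the identity [kdiff_integral]: the
    integral of [k x] over [r, +oo[ is the integral of [K] over [r - x, r + x[.
    It shows that [A B <= c * s] whenever [B <= s] ([rhs_le]), and, for [B >= e] on
    [r, +oo[, that [A B x] is at least [e * (2 * Num.min x r * K (2 * r))] ([rhs_ge]).

    Everything about [Q] comes from its flatness at 0 ([superlinear_at0]): since
    [phi] is concave and not the identity, [phi s > s] on ]0, 1[, and iterating
    [phi s * G u <= G (s * u)] yields [Q u / u -> 0] as [u -> 0].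

    Existence. [G \o A] maps the constant [xi] below itself because [Q xi = c * xi].
    By flatness some small [e] satisfies [Q e <= 2 * K 2 * e], and then the function
    equal to [e] on [1, +oo[ and to 0 elsewhere is mapped above itself. The iterates
    of [xi] decrease, remain above that function, and their pointwise limit is a
    solution by dominated convergence.

    Uniqueness. If [s] is the supremum of a solution then [Q s <= c * s], and the
    convexity and flatness of [Q] force [s <= xi] ([le_xi]). Two solutions [B1], [B2] are
    comparable, [s * B1 <= B2] for some [s] in ]0, 1[ ([comparable_solutions]): at
    infinity because [B2] is bounded below, and near 0 because [A B2] decays at most
    linearly whereas [A B1] decays at least linearly, [K] being Lipschitz. As
    [omega2] is concave in its second argument and vanishes at 0,
    [s * B1 <= B2] implies [s * A B1 <= A B2], and applying [G] gives
    [phi s * B1 <= B2]. The best ratio [s <= 1] can therefore not be less than 1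
    ([solution_le]); by symmetry [B1 = B2]. The functions compared are integrands of
    solutions, whose integrability is part of [is_solution]. *)

(** * Convexity and the half-line *)

Lemma in_Rplus (R : realType) (x : R) : (x \in Rplus R) = (0 <= x).
Proof. by apply/idP/idP; rewrite inE /Rplus/= in_itv/= andbT. Qed.

Lemma RplusP (R : realType) (x : R) : Rplus R x <-> 0 <= x.
Proof. by rewrite /Rplus/= in_itv/= andbT. Qed.

Lemma measurable_Rplus (R : realType) : measurable (Rplus R).
Proof. exact: measurable_itv. Qed.

Lemma in_unit_itv (R : realType) (x : R) : (x \in unit_itv R) = (0 <= x <= 1).
Proof. by apply/idP/idP; rewrite inE /unit_itv/= in_itv/=. Qed.

Lemma convex_on_le (R : realType) (D : set R) (f : R -> R) :
  convex_on D f -> forall a x y : R, 0 <= a <= 1 -> x \in D -> y \in D ->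
  f (a * x + (1 - a) * y) <= a * f x + (1 - a) * f y.
Proof.
move=> cf a x y /andP[a0 a1] xD yD.
have := cf (Itv01 a0 a1) x y xD yD.
by rewrite !convRE /=.
Qed.

Lemma concave_on_ge (R : realType) (D : set R) (f : R -> R) :
  concave_on D f -> forall a x y : R, 0 <= a <= 1 -> x \in D -> y \in D ->
  a * f x + (1 - a) * f y <= f (a * x + (1 - a) * y).
Proof.
move=> cf a x y a01 xD yD; have := convex_on_le cf a01 xD yD.
by rewrite /=; lra.
Qed.

Lemma concave_on_scale (R : realType) (f : R -> R) (s u : R) :
  concave_on (Rplus R) f -> f 0 = 0 -> 0 <= s <= 1 -> 0 <= u ->
  s * f u <= f (s * u).
Proof.
move=> cf f0 s01 u0.
have := concave_on_ge cf s01 (_ : u \in Rplus R) (_ : 0 \in Rplus R).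
by rewrite !in_Rplus f0 !mulr0 !addr0; apply.
Qed.

(** If [phi s0] differs from [s0], then [phi s0 > s0] by concavity between 0 and 1.
    The graph of [phi] lies above the chords joining (s0, phi s0) to (0, 0) and
    to (1, 1), and both chords are strictly above the diagonal inside ]0, 1[. *)
Lemma concave_unit_gt (R : realType) (phi : R -> R) :
  concave_on (unit_itv R) phi -> phi 0 = 0 -> phi 1 = 1 ->
  (exists2 s : R, s \in unit_itv R & phi s != s) ->
  forall s : R, 0 < s < 1 -> s < phi s.
Proof.
move=> cphi phi0 phi1 [s0 + phis0]; rewrite in_unit_itv => /andP[s00 s01].
have I0 : (0 : R) \in unit_itv R by rewrite in_unit_itv lexx ler01.
have I1 : (1 : R) \in unit_itv R by rewrite in_unit_itv lexx ler01.
have Is0 : s0 \in unit_itv R by rewrite in_unit_itv s00 s01.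
have {}s00 : 0 < s0.
  by rewrite lt_neqAle s00 andbT; apply: contraNN phis0 => /eqP <-; rewrite phi0.
have {}s01 : s0 < 1.
  by rewrite lt_neqAle s01 andbT; apply: contraNN phis0 => /eqP ->; rewrite phi1.
have {phis0} phis0 : s0 < phi s0.
  rewrite lt_neqAle eq_sym phis0/=.
  have s001 : 0 <= s0 <= 1 by rewrite !ltW.
  have := concave_on_ge cphi s001 I1 I0.
  by rewrite phi0 phi1 !mulr0 !addr0 !mulr1.
move=> s /andP[sgt0 slt1]; have [ss0|s0s] := leP s s0.
- have a01 : 0 <= s / s0 <= 1.
    by rewrite ler_pdivrMr// mul1r ss0 andbT divr_ge0 ?(ltW sgt0) ?(ltW s00).
  have := concave_on_ge cphi a01 Is0 I0.
  rewrite phi0 !mulr0 !addr0 divfK ?gt_eqF//; apply: lt_le_trans.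
  by rewrite mulrAC ltr_pdivlMr// ltr_pM2l.
- pose a := (1 - s) / (1 - s0).
  have s01' : 0 < 1 - s0 by rewrite subr_gt0.
  have a0 : 0 < a by rewrite divr_gt0// subr_gt0.
  have a01 : 0 <= a <= 1.
    by rewrite (ltW a0)/= /a ler_pdivrMr// mul1r lerD2l lerN2 ltW.
  have sE : a * s0 + (1 - a) * 1 = s.
    by rewrite /a; field; rewrite gt_eqF.
  have := concave_on_ge cphi a01 Is0 I1; rewrite sE phi1; apply: lt_le_trans.
  by rewrite -[ltLHS]sE ltrD2r ltr_pM2l.
Qed.

(** * The nonlinearity Q and its inverse *)

Section half_line_bijection.
Variables (R : realType) (Q G : R -> R).
Hypothesis Q_nd : nondecreasing_on (Rplus R) Q.
Hypothesis QG : inverse_on_Rplus Q G.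

Lemma G_ge0 (u : R) : 0 <= u -> 0 <= G u. Proof. by move=> /QG[]. Qed.
Lemma GK (u : R) : 0 <= u -> Q (G u) = u. Proof. by move=> /QG[]. Qed.
Lemma QK (u : R) : 0 <= u -> G (Q u) = u. Proof. by move=> /QG[]. Qed.

Lemma Q_le (u v : R) : 0 <= u -> 0 <= v -> (Q u <= Q v) = (u <= v).
Proof.
move=> u0 v0; apply/idP/idP => [Quv|uv]; last by apply: Q_nd; rewrite ?in_Rplus.
rewrite leNgt; apply/negP => vu.
have : Q v = Q u.
  by apply/eqP; rewrite eq_le Quv andbT Q_nd ?in_Rplus// ltW.
by move=> /(congr1 G); rewrite !QK// => /eqP; rewrite lt_eqF.
Qed.

Lemma G_le (u v : R) : 0 <= u -> 0 <= v -> (G u <= G v) = (u <= v).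
Proof. by move=> u0 v0; rewrite -(Q_le (G_ge0 u0) (G_ge0 v0)) !GK. Qed.

Lemma G_gt0 (u : R) : Q 0 = 0 -> 0 < u -> 0 < G u.
Proof.
move=> Q0 u0; rewrite lt_neqAle G_ge0 ?ltW// andbT; apply/eqP => G0.
by have := GK (ltW u0); rewrite -G0 Q0 => /eqP; rewrite lt_eqF.
Qed.

End half_line_bijection.

(** That [phi s * G u <= G (s * u)] with [phi] strictly above the identity makes [Q]
    flat at 0. With convexity, [xi] is then the only positive solution of
    [Q s = c * s], and the zero solution is repelling. *)
Section superlinear.
Variables (R : realType) (Q G phi : R -> R) (xi c : R).
Hypothesis Q_nd : nondecreasing_on (Rplus R) Q.
Hypothesis QG : inverse_on_Rplus Q G.
Hypothesis Q0 : Q 0 = 0.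
Hypothesis Q_convex : convex_on (Rplus R) Q.
Hypotheses (xi_gt0 : 0 < xi) (c_ge1 : 1 <= c) (Q_xi : Q xi = c * xi).
Hypothesis phi_gt : forall s : R, 0 < s < 1 -> s < phi s.
Hypothesis G_phi : forall s u : R, 0 < s < 1 -> 0 < u < c * xi ->
  phi s * G u <= G (s * u).

(** The inequality extends to the closed interval: if it failed at the right end,
    monotonicity of [G] would make it fail at nearby smaller arguments. *)
Lemma G_phi_le (s u : R) : 0 < s < 1 -> 0 <= u <= c * xi -> phi s * G u <= G (s * u).
Proof.
move=> s01; have /andP[s0 s1] := s01; have sphi := phi_gt s01.
have phis0 : 0 < phi s by exact: lt_trans sphi.
move=> /andP[]; rewrite le_eqVlt => /predU1P[<- _|u0].
  have -> : G 0 = 0 by rewrite -{1}Q0 (QK QG).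
  by rewrite !mulr0 (G_ge0 QG).
rewrite le_eqVlt => /predU1P[uE|u1]; last by apply: G_phi; rewrite ?u0.
have su0 : 0 < s * u by rewrite mulr_gt0.
rewrite leNgt; apply/negP => Gsu.
(* v lies strictly between G (s * u) / phi s and G u, so Q v < u *)
pose v := (G (s * u) / phi s + G u) / 2.
have Gsu' : G (s * u) / phi s < G u by rewrite ltr_pdivrMr// [ltRHS]mulrC.
have Gsu0 : 0 < G (s * u) / phi s by rewrite divr_gt0// (G_gt0 QG).
have v0 : 0 < v by rewrite /v; lra.
have vu : v < G u by rewrite /v; lra.
have Qvu : Q v < u.
  rewrite -[ltRHS](GK QG (ltW u0)) ltNge (Q_le Q_nd QG) -?ltNge//.
    exact: (G_ge0 QG (ltW u0)).
  exact: ltW.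
have Qv0 : 0 < Q v.
  rewrite -Q0 ltNge (Q_le Q_nd QG) -?ltNge//; exact: ltW.
have := @G_phi s (Q v) s01; rewrite Qv0 -uE Qvu => /(_ isT).
rewrite (QK QG (ltW v0)) => h.
have : G (s * Q v) <= G (s * u).
  by rewrite (G_le Q_nd QG) ?ler_pM2l ?mulr_ge0// ltW.
move/(le_trans h); rewrite [leLHS]mulrC -ler_pdivlMr// leNgt => /negP; apply.
by rewrite /v; lra.
Qed.

(** Iterating [phi s * G u <= G (s * u)] along the points [s ^+ n * u] gives
    [G (s ^+ n * u) >= phi s ^+ n * G u], whereas the arguments only shrink like
    [s ^+ n]; as [s / phi s < 1], the slope of [G] blows up at 0, so that [Q] has
    arbitrarily small slopes there. *)
Lemma superlinear_at0 (d : R) : 0 < d -> exists2 e : R, 0 < e <= xi & Q e <= d * e.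
Proof.
move=> d0; have [s s01] : exists s : R, 0 < s < 1 by exists (1 / 2); lra.
have /andP[s0 s1] := s01; have sphi := phi_gt s01.
have phis0 : 0 < phi s by exact: lt_trans sphi.
pose u := xi / 2.
have u0 : 0 < u by rewrite divr_gt0.
have xi0 := xi_gt0.
have uc : u < c * xi.
  have h : xi <= c * xi by rewrite ler_pMl.
  by rewrite /u; lra.
have sn0 n : 0 < s ^+ n by rewrite exprn_gt0.
have snu0 n : 0 < s ^+ n * u by rewrite mulr_gt0.
have snu n : s ^+ n * u <= u.
  by rewrite ler_piMl ?(ltW u0)// exprn_ile1// ltW.
have iter n : phi s ^+ n * G u <= G (s ^+ n * u).
  elim: n => [|n IH]; first by rewrite !expr0 !mul1r.
  have hn : 0 < s ^+ n * u < c * xi by rewrite snu0 (le_lt_trans (snu n)).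
  by rewrite !exprS -!mulrA (le_trans _ (G_phi s01 hn))// ler_pM2l.
have Gu0 : 0 < G u by rewrite (G_gt0 QG).
have [n hn] : exists n, (s / phi s) ^+ n < d * G u / u.
  have : `|s / phi s| < 1.
    by rewrite ger0_norm ?divr_ge0 ?ltW// ltr_pdivrMr// mul1r.
  move=> /cvg_expr/cvgrPdist_lt/(_ (d * G u / u)); rewrite !divr_gt0 ?mulr_gt0//.
  move=> /(_ isT)[n _ /(_ n (leqnn n))] /=; rewrite sub0r normrN => h.
  by exists n; exact: le_lt_trans (ler_norm _) h.
exists (G (s ^+ n * u)).
  rewrite (G_gt0 QG)//= -(Q_le Q_nd QG) ?(G_ge0 QG) ?(ltW xi_gt0) ?(ltW (snu0 n))//.
  by rewrite (GK QG) ?(ltW (snu0 n))// Q_xi ltW// (le_lt_trans (snu n)).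
rewrite (GK QG) ?(ltW (snu0 n))//.
apply: (@le_trans _ _ (d * (phi s ^+ n * G u))); last by rewrite ler_pM2l.
move: hn; rewrite expr_div_n ltr_pdivlMr// mulrAC ltr_pdivrMr ?exprn_gt0//.
by move=> /ltW; rewrite -mulrA [G u * _]mulrC.
Qed.

(** By convexity [Q u / u] is nondecreasing, so a point [s > xi] whose slope is at
    most that of [xi] would make [Q] linear on [0, s], against its flatness
    at 0. This bounds every solution by [xi]. *)
Lemma le_xi (s : R) : 0 <= s -> Q s <= c * s -> s <= xi.
Proof.
move=> s0 Qs; rewrite leNgt; apply/negP => xis.
have [|e /andP[e0 exi] Qe] := @superlinear_at0 (c / 2).
  by rewrite divr_gt0// (lt_le_trans ltr01).
have c1 := c_ge1; have xi0 := xi_gt0.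
have ese : 0 < s - e by lra.
pose a := (s - xi) / (s - e).
have a0 : 0 < a by rewrite divr_gt0//; lra.
have a01 : 0 <= a <= 1 by rewrite (ltW a0)/= /a ler_pdivrMr//; lra.
have xiE : a * e + (1 - a) * s = xi by rewrite /a; field; rewrite gt_eqF.
have := convex_on_le Q_convex a01 (_ : e \in Rplus R) (_ : s \in Rplus R).
rewrite !in_Rplus xiE Q_xi => /(_ (ltW e0) s0).
have /andP[_ a1] := a01.
have h1 : a * Q e <= a * (c / 2 * e) by rewrite ler_pM2l.
have h2 : (1 - a) * Q s <= (1 - a) * (c * s) by rewrite ler_wpM2l//; lra.
have h3 : 0 < a * (c / 2 * e).
  by rewrite mulr_gt0// mulr_gt0// divr_gt0//; lra.
move=> h4; move: h1 h2 h3 h4; rewrite -xiE => *; lra.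
Qed.

End superlinear.

(** * Translation invariance *)

Section translation.
Variable R : realType.
Notation mu := (@lebesgue_measure R).

(** It suffices to compare the two measures on the half-open intervals, whose
    length is invariant. *)
Lemma lebesgue_measure_translation (a : R) (A : set R) : measurable A ->
  pushforward mu ((fun t => t + a) : _ -> measurableTypeR R) A = mu A.
Proof.
move=> mA; apply/esym/lebesgue_measure_unique => //=.
  exact: measurable_funD.
move=> _ _ [[u v]] _ <-.
rewrite /pushforward.
have -> : (fun t => t + a) @^-1` `]u, v] = `]u - a, v - a]%classic.
  by apply/seteqP; split=> x /=; rewrite !in_itv/= ltrBlDr lerBrDr.
rewrite !lebesgue_measure_itv/= !lte_fin ltrD2r.
by case: ifPn => // _; congr (_%:E); ring.
Qed.

Lemma ge0_integral_translation (a : R) (A : set R) (f : R -> R) :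
  measurable A -> measurable_fun setT f -> (forall t, 0 <= f t) ->
  (\int[mu]_(t in (fun t => t + a)%R @^-1` A) (f (t + a)%R)%:E =
   \int[mu]_(t in A) (f t)%:E)%E.
Proof.
move=> mA mf f0.
pose tr : measurableTypeR R -> measurableTypeR R := fun t => t + a.
have ma : measurable_fun setT tr by exact: measurable_funD.
have mEf : measurable_fun A (EFin \o f).
  by apply: measurable_funTS; exact/measurable_EFinP.
have f0' : {in A, forall t, (0 <= (EFin \o f) t)%E} by move=> t _; rewrite lee_fin.
have trE := ge0_integral_pushforward ma lebesgue_measure mA mEf f0'.
apply: (etrans (esym trE)); apply: eq_measure_integral => // B mB _.
exact: lebesgue_measure_translation.
Qed.

Lemma integrable_translation (a : R) (A : set R) (f : R -> R) :
  measurable A -> measurable_fun setT f -> (forall t, 0 <= f t) ->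
  mu.-integrable A (EFin \o f) ->
  mu.-integrable ((fun t => t + a) @^-1` A) (EFin \o (fun t => f (t + a))).
Proof.
move=> mA mf f0 /integrableP[_ foo].
have ma : measurable_fun setT (fun t : R => t + a) by exact: measurable_funD.
apply/integrableP; split.
  apply/measurable_EFinP/measurable_funTS.
  exact: (measurableT_comp mf ma).
under eq_integral do rewrite /= ger0_norm//.
rewrite (ge0_integral_translation a mA mf f0).
by move: foo; under eq_integral do rewrite /= ger0_norm//.
Qed.

Lemma Rintegral_translation (a : R) (A : set R) (f : R -> R) :
  measurable A -> measurable_fun setT f -> (forall t, 0 <= f t) ->
  \int[mu]_(t in (fun t => t + a) @^-1` A) f (t + a) =
  \int[mu]_(t in A) f t.
Proof. by move=> *; rewrite /Rintegral ge0_integral_translation. Qed.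

End translation.

(** * The difference kernel *)

(** Convolution with an even [K], acting on odd functions, folded onto the half-line. *)
Definition kdiff (R : realType) (K : R -> R) (x t : R) : R := K (x - t) - K (x + t).

Lemma integrable_cst_itv (R : realType) (a b c : R) :
  lebesgue_measure.-integrable `[a, b[ (EFin \o (cst c : R -> R)).
Proof.
apply: measurable_bounded_integrable => //.
  by rewrite /= lebesgue_measure_itv/=; case: ifPn => _; rewrite ?ltry// -EFinB ltry.
exact: bounded_cst.
Qed.

Lemma Rintegral_cst_itv (R : realType) (a b c : R) : a <= b ->
  \int[lebesgue_measure]_(t in `[a, b[) cst c t = c * (b - a).
Proof.
move=> ab; rewrite Rintegral_cst//= lebesgue_measure_itv/= lte_fin.
case: ltP => [_//|ba]; have -> : a = b by apply: le_anti; rewrite ab ba.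
by rewrite subrr.
Qed.

Section difference_kernel.
Variables (R : realType) (K : R -> R).
Notation mu := (@lebesgue_measure R).
Hypothesis K_gt0 : forall x : R, 0 < K x.
Hypothesis K_even : forall t : R, 0 <= t -> K (- t) = K t.
Hypothesis K_derivable : forall x : R, derivable K x 1.
Hypothesis K_decr : nonincreasing_on (Rplus R) K.
Hypothesis K_int :
  (\int[lebesgue_measure]_(t in Rplus R) (K t)%:E = (2^-1)%:E)%E.

Lemma K_sym (t : R) : K (- t) = K t.
Proof.
have [t0|/ltW t0] := leP 0 t; first exact: K_even.
by rewrite -[in RHS](opprK t) [RHS]K_even// oppr_ge0.
Qed.

Lemma K_abs (t : R) : K t = K `|t|.
Proof. by have [t0|t0] := ger0P t; rewrite // K_sym. Qed.

Lemma K_abs_le (s t : R) : `|s| <= `|t| -> K t <= K s.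
Proof. by move=> st; rewrite K_abs [leRHS]K_abs K_decr// in_Rplus. Qed.

Lemma K_continuous : continuous K.
Proof.
by move=> x; apply: differentiable_continuous; exact/derivable1_diffP.
Qed.

Lemma K_measurable (D : set R) : measurable_fun D K.
Proof.
by apply: measurable_funTS; apply: continuous_measurable_fun; exact: K_continuous.
Qed.

Let K_ge0 (t : R) : 0 <= K t. Proof. exact: ltW. Qed.

Lemma K_integralT : (\int[mu]_t (K t)%:E = 1)%E.
Proof.
rewrite ge0_symfun_integralT//; last 2 first.
- exact: K_continuous.
- by move=> x /=; rewrite K_sym.
have -> : [set x : R | 0 <= x] = Rplus R by rewrite /Rplus set_itvcy.
by rewrite K_int -EFinM divff.
Qed.

Lemma K_integrable (D : set R) : measurable D -> mu.-integrable D (EFin \o K).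
Proof.
move=> mD; apply: (@integrableS _ _ _ mu setT) => //.
apply/integrableP; split; first by apply/measurable_EFinP; exact: K_measurable.
by under eq_integral do rewrite /= ger0_norm//; rewrite K_integralT ltry.
Qed.

Lemma kdiff_ge0 (x t : R) : 0 <= x -> 0 <= t -> 0 <= kdiff K x t.
Proof.
move=> x0 t0; rewrite subr_ge0 K_abs_le// [leRHS]ger0_norm ?addr_ge0//.
by rewrite ler_norml; lra.
Qed.

(** Mean value theorem between the reflected point [t - x] and [t + x]. *)
Lemma kdiff_le_lipschitz (L x t : R) : (forall y, `|derive1 K y| <= L) ->
  0 <= x -> kdiff K x t <= 2 * x * L.
Proof.
move=> KL x0; have tx : - x + t <= x + t by lra.
have [||c _ Kc] := @MVT_segment R K (derive1 K) _ _ tx.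
- by move=> y _; rewrite derive1E; exact: derivableP.
- exact/continuous_subspaceT/K_continuous.
have -> : kdiff K x t = - derive1 K c * (2 * x).
  rewrite /kdiff -(K_sym (x - t)) opprB (addrC t (- x)) -opprB Kc; ring.
rewrite mulrC ler_wpM2l ?mulr_ge0//.
by rewrite (le_trans _ (KL c))// -normrN ler_norm.
Qed.

Lemma kdiff_le (S x t : R) : (forall y, K y <= S) -> kdiff K x t <= S.
Proof. by move=> KS; have := KS (x - t); have := K_gt0 (x + t); rewrite /kdiff; lra. Qed.

Lemma K_translate (a r : R) :
  mu.-integrable `[r, +oo[ (EFin \o (fun t => K (t + a))) /\
  \int[mu]_(t in `[r, +oo[) K (t + a) = \int[mu]_(t in `[r + a, +oo[) K t.
Proof.
have pre : (fun t : R => t + a) @^-1` `[r + a, +oo[ = `[r, +oo[%classic.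
  by apply/seteqP; split=> t /=; rewrite !in_itv/= !andbT lerD2r.
split; rewrite -{1}pre.
- apply: integrable_translation => //; first exact: K_measurable.
  exact: K_integrable.
- by apply: Rintegral_translation => //; exact: K_measurable.
Qed.

Let kdiffE (x : R) : kdiff K x = (fun t => K (t + - x) - K (t + x)).
Proof. by apply/funext => t; rewrite /kdiff -(K_sym (x - t)) opprB (addrC x). Qed.

Lemma kdiff_integrable (r x : R) : mu.-integrable `[r, +oo[ (EFin \o kdiff K x).
Proof.
rewrite kdiffE; apply: (@integrableB _ _ _ _ _ _ (EFin \o _) (EFin \o _)) => //.
- by have [] := K_translate (- x) r.
- by have [] := K_translate x r.
Qed.

(** After translation and reflection the two terms of the kernel become tails of
    the same function [K], whose difference is the mass of [K] over a bounded
    interval. All the bounds on the mass of the kernel are read off from this. *)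
Lemma kdiff_integral (r x : R) : 0 <= x ->
  \int[mu]_(t in `[r, +oo[) kdiff K x t = \int[mu]_(t in `[r - x, r + x[) K t.
Proof.
move=> x0; rewrite kdiffE.
have [iN IN] := K_translate (- x) r; have [iP IP] := K_translate x r.
rewrite RintegralB// IN IP.
have -> : `[r + - x, +oo[%classic = `[r - x, r + x[ `|` `[r + x, +oo[.
  by apply: itv_bndbnd_setU; rewrite bnd_simp// lerD2l; lra.
rewrite Rintegral_setU//; first by rewrite addrK.
- by apply: K_integrable; exact: measurableU.
- apply/disj_setPS => t /= []; rewrite !in_itv/= !andbT.
  by move=> /andP[_ /lt_le_trans h] /h; rewrite ltxx.
Qed.

Lemma kdiff_mass_le1 (x : R) :
  0 <= x -> \int[mu]_(t in Rplus R) kdiff K x t <= 1.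
Proof.
move=> x0; rewrite kdiff_integral//.
rewrite -lee_fin /Rintegral fineK; last exact/integrable_fin_num/K_integrable.
rewrite -K_integralT.
apply: ge0_subset_integral => //; last by move=> t _; rewrite lee_fin.
by apply/measurable_EFinP; exact: K_measurable.
Qed.

Lemma kdiff_mass_le (S x : R) : (forall y, K y <= S) ->
  0 <= x -> \int[mu]_(t in Rplus R) kdiff K x t <= 2 * x * S.
Proof.
move=> KS x0; rewrite kdiff_integral//.
apply: (@le_trans _ _ (\int[mu]_(t in `[0 - x, 0 + x[) cst S t)).
  apply: le_Rintegral => //; first exact: K_integrable.
  exact: integrable_cst_itv.
rewrite Rintegral_cst_itv; last by lra.
by rewrite le_eqVlt; apply/orP; left; apply/eqP; ring.
Qed.

(** The interval of length [2 * Num.min x r] centred at [r] is contained in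
    [r - x, r + x[ and in [0, 2 * r], where [K] is at least [K (2 * r)]. The bound
    is uniform in [x >= r] and linear in [x <= r]; both regimes are needed. *)
Lemma kdiff_tail_ge (r x : R) : 0 <= r -> 0 <= x ->
  2 * Num.min x r * K (2 * r) <= \int[mu]_(t in `[r, +oo[) kdiff K x t.
Proof.
move=> r0 x0; rewrite kdiff_integral//.
set m := Num.min x r.
have mx : m <= x by rewrite ge_min lexx.
have mr : m <= r by rewrite ge_min lexx orbT.
have m0 : 0 <= m by rewrite le_min x0.
apply: (@le_trans _ _ (\int[mu]_(t in `[r - m, r + m[) K t)); last first.
  rewrite /Rintegral fine_le//.
  - exact/integrable_fin_num/K_integrable.
  - exact/integrable_fin_num/K_integrable.
  - apply: ge0_subset_integral => //.
    + by apply/measurable_EFinP; exact: K_measurable.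
    + by move=> t _; rewrite lee_fin.
    + by apply: subset_itv; rewrite bnd_simp; lra.
apply: (@le_trans _ _ (\int[mu]_(t in `[r - m, r + m[) cst (K (2 * r)) t)).
  rewrite Rintegral_cst_itv; last by lra.
  by rewrite le_eqVlt; apply/orP; left; apply/eqP; ring.
apply: le_Rintegral => //; [|exact: K_integrable|].
  exact: integrable_cst_itv.
move=> t /=; rewrite in_itv/= => /andP[t1 t2].
apply: K_abs_le; rewrite !ger0_norm; lra.
Qed.

End difference_kernel.

(** * Measurability of superpositions and of integral operators *)

Lemma within_continuous_cvg (T U : topologicalType) (A : set T) (f : T -> U)
    (I : Type) (F : set_system I) {FF : Filter F} (g : I -> T) (x : T) :
  {within A, continuous f} -> A x -> (\forall i \near F, A (g i)) ->
  g @ F --> x -> f \o g @ F --> f x.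
Proof.
move=> /subspace_continuousP cf Ax Ag gx; apply: cvg_comp (cf x Ax).
move=> P /gx; rewrite /nbhs/= => gP.
by apply: filterS2 Ag gP => i Agi; exact.
Qed.

Lemma nondecreasing_on_measurable (R : realType) (f : R -> R) :
  nondecreasing_on (Rplus R) f -> measurable_fun (Rplus R) f.
Proof.
move=> f_nd.
have m0 (x : R) : Num.max 0 x \in Rplus R by rewrite in_Rplus le_max lexx.
apply: (@eq_measurable_fun _ _ _ _ (Rplus R) (fun x => f (Num.max 0 x))).
  by move=> x; rewrite in_Rplus => /max_r ->.
apply: nondecreasing_measurable; first exact: measurable_Rplus.
move=> x y xy; apply: f_nd => //.
by rewrite ge_max !le_max lexx/= xy orbT.
Qed.

Section superposition.
Variables (R : realType) (w : R -> R -> R).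
Hypothesis w0 : forall t : R, 0 <= t -> w t 0 = 0.
Hypothesis w_continuous :
  {within Rplus R `*` Rplus R, continuous (fun p : R * R => w p.1 p.2)}.
Hypothesis w_incr : forall t : R, 0 <= t -> nondecreasing_on (Rplus R) (w t).
Hypothesis w_concave : forall t : R, 0 <= t -> concave_on (Rplus R) (w t).

Lemma superposition_cvg (t : R) (u_ : R^nat) (u : R) : 0 <= t -> 0 <= u ->
  (forall n, 0 <= u_ n) -> u_ @ \oo --> u -> (fun n => w t (u_ n)) @ \oo --> w t u.
Proof.
move=> t0 u0 un0 uu.
apply: (within_continuous_cvg (g := fun n => (t, u_ n)) (x := (t, u)) w_continuous).
- by split=> /=; apply/RplusP.
- by apply: filterE => n; split=> /=; apply/RplusP.
- by apply: (@cvg_pair _ _ _ _ (nbhs t) (nbhs u)) => //; exact: cvg_cst.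
Qed.

Lemma superposition_section_measurable (u : R) : 0 <= u ->
  measurable_fun (Rplus R) (w ^~ u).
Proof.
move=> u0; apply: subspace_continuous_measurable_fun; first exact: measurable_Rplus.
apply/subspace_continuousP => t Dt.
apply: (within_continuous_cvg (g := fun t => (t, u)) (x := (t, u)) w_continuous).
- by split => //=; apply/RplusP.
- apply: filterS (withinT _ _) => s Ds; split=> //=; exact/RplusP.
- by apply: (@cvg_pair _ _ _ _ (nbhs t) (nbhs u)); [exact: cvg_within|exact: cvg_cst].
Qed.

(** Along the rationals, [w t (B t) > a] holds iff [w t q > a] for some
    [q] with [0 <= q <= B t]:
    monotonicity gives one direction, and concavity with [w t 0 = 0] lets a
    rational slightly below [B t] serve in the other. Each set on the right
    is an intersection of two measurable sets. *)
Lemma superposition_measurable (B : R -> R) :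
  (forall t, 0 <= t -> 0 <= B t) -> measurable_fun (Rplus R) B ->
  measurable_fun (Rplus R) (fun t => w t (B t)).
Proof.
move=> B0 mB; have mD := @measurable_Rplus R.
move=> _; apply: (measurability _ (RGenOInfty.measurableE R)) => //.
move=> _ [_ [a ->] <-].
have -> : Rplus R `&` (fun t => w t (B t)) @^-1` `]a, +oo[ =
  \bigcup_(q : rat) [set t | [/\ Rplus R t, 0 <= ratr q :> R, ratr q <= B t & a < w t (ratr q)]].
  apply/seteqP; split=> [t [Dt]|t [q _ /= [Dt q0 qB aw]]]; last first.
    split=> //=; rewrite in_itv/= andbT (lt_le_trans aw)//.
    have t0 : 0 <= t by exact/RplusP.
    by apply: w_incr; rewrite ?in_Rplus// B0.
  rewrite /= in_itv/= andbT => aw; have t0 : 0 <= t by exact/RplusP.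
  have [a0|a0] := ltP a 0.
    by exists 0 => //=; split=> //; rewrite raddf0 ?B0// w0.
  have wB0 : 0 < w t (B t) by exact: le_lt_trans aw.
  have Bt0 : 0 < B t.
    rewrite lt_neqAle B0// andbT; apply/eqP => BE.
    by move: wB0; rewrite -BE w0// ltxx.
  (* above this left end point, concavity pushes [w t] beyond [a] *)
  have [q /itvP qB] : exists q, ratr q \in `](a / w t (B t) * B t), (B t)[.
    by apply: rat_in_itvoo; rewrite gtr_pMl// ltr_pdivrMr// mul1r.
  have q0 : 0 <= ratr q :> R.
    by rewrite (le_trans _ (ltW _ : a / w t (B t) * B t <= _)) ?qB// mulr_ge0 ?divr_ge0// ltW.
  exists q => //=; split=> //; first by rewrite qB.
  have s01 : 0 <= ratr q / B t <= 1.
    by rewrite ler_pdivrMr// mul1r qB andbT divr_ge0// ltW.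
  have := concave_on_scale (w_concave t0) (w0 t0) s01 (ltW Bt0).
  rewrite divfK ?gt_eqF//; apply: lt_le_trans.
  by rewrite -ltr_pdivrMr// ltr_pdivlMr// qB.
apply: bigcupT_measurable_rat => q.
have [q0|q0] := boolP (0 <= ratr q :> R); last first.
  rewrite (_ : [set t | _] = set0)//; apply/seteqP.
  by split=> // t [_ q0' _ _]; case/negP: q0.
rewrite (_ : [set t | _] = (Rplus R `&` B @^-1` `[ratr q, +oo[) `&`
    (Rplus R `&` (w ^~ (ratr q)) @^-1` `]a, +oo[)).
  apply: measurableI.
    by apply: mB => //; exact: measurable_itv.
  by apply: superposition_section_measurable => //; exact: measurable_itv.
apply/seteqP; split=> t /=; rewrite !in_itv/= !andbT.
  by move=> [].
by move=> [[Dt ?] [_ ?]].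
Qed.

End superposition.

Section kernel_operator_measurable.
Variables (R : realType) (k : R -> R -> R).
Notation mu := (@lebesgue_measure R).
Hypothesis mk : measurable_fun setT (fun p : measurableTypeR R * measurableTypeR R => k p.1 p.2).
Hypothesis k0 : forall x t, 0 <= x -> 0 <= t -> 0 <= k x t.

(** Tonelli applied to the extension of the integrand by zero. *)
Lemma kernel_operator_measurable (f : R -> R) :
  (forall t, 0 <= t -> 0 <= f t) -> measurable_fun (Rplus R) f ->
  measurable_fun (Rplus R) (fun x => \int[mu]_(t in Rplus R) (k x t * f t)).
Proof.
move=> f0 mf; have mD := @measurable_Rplus R.
pose h (p : measurableTypeR R * measurableTypeR R) : \bar R :=
  (`|k p.1 p.2 * (f \_ (Rplus R)) p.2|)%:E.
have mh : measurable_fun setT h.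
  apply/measurable_EFinP; apply: measurableT_comp => //.
  apply: measurable_funM => //.
  apply: (measurableT_comp (f := f \_ (Rplus R))); last exact: measurable_snd.
  exact/(measurable_restrictT _ mD).
have h0 p : (0 <= h p)%E by rewrite lee_fin.
have := @measurable_fun_fubini_tonelli_F _ _ _ _ _ mu h mh h0.
move=> /(measurableT_comp (fine_measurable measurableT)) mF.
apply: (@eq_measurable_fun _ _ _ _ (Rplus R) (fine \o fubini_F mu h)); last exact: measurable_funTS.
move=> x; rewrite in_Rplus => x0.
rewrite [RHS]Rintegral_mkcond; apply: eq_Rintegral => t _.
rewrite /h /= /restrict; case: ifPn => [|_]; last by rewrite mulr0 normr0.
by rewrite in_Rplus => t0; rewrite ger0_norm// mulr_ge0 ?k0 ?f0.
Qed.

End kernel_operator_measurable.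

(** * Integrals against a bounded kernel *)

(** Integrals of [f] against a kernel [k] bounded by [C], where [f] is controlled
    by [s * (1 + m)]; in the application [f] is [B + omega2 (B)], [s] is a bound on
    [B] and [m] is the slope of [omega2]. *)
Section weighted_integral.
Variables (R : realType) (k m : R -> R) (C : R).
Notation mu := (@lebesgue_measure R).
Hypothesis k_ge0 : forall t : R, 0 <= t -> 0 <= k t.
Hypothesis k_le : forall t : R, 0 <= t -> k t <= C.
Hypothesis ik : mu.-integrable (Rplus R) (EFin \o k).
Hypothesis m_ge0 : forall t : R, 0 <= t -> 0 <= m t.
Hypothesis im : mu.-integrable (Rplus R) (EFin \o m).

Let mD : measurable (Rplus R : set (measurableTypeR R)). Proof. exact: measurable_Rplus. Qed.

Let iCm (s : R) : mu.-integrable (Rplus R) (EFin \o (fun t => s * C * m t)).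
Proof.
have := integrableZl mD (s * C) im.
by apply: eq_integrable => // t _ /=; rewrite EFinM.
Qed.

Let isk (s : R) : mu.-integrable (Rplus R) (EFin \o (fun t => s * k t)).
Proof.
have := integrableZl mD s ik.
by apply: eq_integrable => // t _ /=; rewrite EFinM.
Qed.

Let idom (s : R) : mu.-integrable (Rplus R) (EFin \o (fun t => s * k t + s * C * m t)).
Proof.
have := integrableD mD (isk s) (iCm s).
by apply: eq_integrable => // t _ /=; rewrite EFinD.
Qed.

Let dom_ge (f : R -> R) (s t : R) : 0 <= s -> 0 <= t -> f t <= s + m t * s ->
  k t * f t <= s * k t + s * C * m t.
Proof.
move=> s0 t0 fs; apply: (@le_trans _ _ (k t * (s + m t * s))).
  by rewrite ler_wpM2l// k_ge0.
rewrite mulrDr (mulrC (k t) s) lerD2l.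
have := k_le t0; have := m_ge0 t0; have := k_ge0 t0 => k0 m0 kC.
have -> : k t * (m t * s) = (s * m t) * k t by ring.
have -> : s * C * m t = (s * m t) * C by ring.
by rewrite ler_wpM2l// mulr_ge0.
Qed.

Lemma weighted_integrable (f : R -> R) (s : R) : 0 <= s ->
  measurable_fun (Rplus R) f ->
  (forall t : R, 0 <= t -> 0 <= f t <= s + m t * s) ->
  mu.-integrable (Rplus R) (EFin \o (fun t => k t * f t)).
Proof.
move=> s0 mf fs; apply: (le_integrable mD _ _ (idom s)).
  apply/measurable_EFinP; apply: measurable_funM => //.
  by apply/measurable_EFinP; exact: measurable_int ik.
move=> t /RplusP t0; have /andP[f0 fs1] := fs t t0.
rewrite /= lee_fin ger0_norm; last by rewrite mulr_ge0// k_ge0.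
by rewrite (le_trans (dom_ge s0 t0 fs1))// ler_norm.
Qed.

Lemma weighted_integral_le (f : R -> R) (s : R) : 0 <= s ->
  mu.-integrable (Rplus R) (EFin \o (fun t => k t * f t)) ->
  (forall t : R, 0 <= t -> f t <= s + m t * s) ->
  \int[mu]_(t in Rplus R) (k t * f t) <=
  s * (\int[mu]_(t in Rplus R) k t + C * \int[mu]_(t in Rplus R) m t).
Proof.
move=> s0 ikf fs; rewrite mulrDr mulrA -!RintegralZl// -RintegralD//.
by apply: le_Rintegral => // t /RplusP t0; exact: dom_ge (fs t t0).
Qed.

Lemma weighted_integral_ge (f : R -> R) (e r : R) : 0 <= r ->
  mu.-integrable (Rplus R) (EFin \o (fun t => k t * f t)) ->
  (forall t : R, 0 <= t -> 0 <= f t) -> (forall t : R, r <= t -> e <= f t) ->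
  e * \int[mu]_(t in `[r, +oo[) k t <= \int[mu]_(t in Rplus R) (k t * f t).
Proof.
move=> r0 ikf f0 fe.
have mr : measurable (`[r, +oo[%classic : set (measurableTypeR R)).
  exact: measurable_itv.
have rD : `[r, +oo[%classic `<=` Rplus R.
  by move=> t /=; rewrite in_itv/= andbT => /(le_trans r0)/RplusP.
have ikr : mu.-integrable `[r, +oo[ (EFin \o k) by exact: (integrableS mD).
have ikfr : mu.-integrable `[r, +oo[ (EFin \o (fun t => k t * f t)).
  exact: (integrableS mD).
rewrite -RintegralZl//.
apply: (@le_trans _ _ (\int[mu]_(t in `[r, +oo[) (k t * f t))).
  apply: le_Rintegral => //.
    have := integrableZl mr e ikr.
    by apply: eq_integrable => // t _ /=; rewrite EFinM.
  move=> t rt; have /RplusP t0 := rD _ rt.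
  rewrite mulrC ler_wpM2l ?k_ge0 ?fe//.
  by move: rt; rewrite /= in_itv/= andbT.
rewrite /Rintegral fine_le//.
- exact: integrable_fin_num.
- exact: integrable_fin_num.
- apply: ge0_subset_integral => //; first exact: measurable_int ikf.
  by move=> t /RplusP t0; rewrite lee_fin mulr_ge0 ?k_ge0 ?f0.
Qed.

End weighted_integral.

(** * The integral equation *)

Section equation.
Variables (R : realType) (K : R -> R) (omega2 : R -> R -> R) (Q mu2 G phi : R -> R) (xi : R).
Notation mu := (@lebesgue_measure R).
Notation c := (1 + Mconst K mu2).
Hypothesis K_gt0 : forall x : R, 0 < K x.
Hypothesis K_even : forall t : R, 0 <= t -> K (- t) = K t.
Hypothesis K_derivable : forall x : R, derivable K x 1.
Hypothesis K_bounded : [bounded (K x : R^o) | x in [set: R]].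
Hypothesis K'_bounded : [bounded (derive1 K x : R^o) | x in [set: R]].
Hypothesis K_decr : nonincreasing_on (Rplus R) K.
Hypothesis K_int :
  (\int[lebesgue_measure]_(t in Rplus R) (K t)%:E = (2^-1)%:E)%E.
Hypothesis Q_ge0 : forall u : R, 0 <= u -> 0 <= Q u.
Hypothesis Q0 : Q 0 = 0.
Hypothesis omega2_0 : forall t : R, 0 <= t -> omega2 t 0 = 0.
Hypothesis omega2_continuous :
  {within Rplus R `*` Rplus R, continuous (fun p : R * R => omega2 p.1 p.2)}.
Hypothesis omega2_incr : forall t : R, 0 <= t -> nondecreasing_on (Rplus R) (omega2 t).
Hypothesis omega2_concave : forall t : R, 0 <= t -> concave_on (Rplus R) (omega2 t).
Hypothesis mu2_gt0 : forall t : R, 0 <= t -> 0 < mu2 t.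
Hypothesis mu2_integrable : lebesgue_measure.-integrable (Rplus R) (EFin \o mu2).
Hypothesis omega2_le : forall t u : R, 0 <= t -> 0 <= u -> omega2 t u <= mu2 t * u.
Hypothesis Q_continuous : {within Rplus R, continuous Q}.
Hypothesis Q_incr : nondecreasing_on (Rplus R) Q.
Hypothesis Q_convex : convex_on (Rplus R) Q.
Hypothesis xi_gt0 : 0 < xi.
Hypothesis Q_xi : Q xi = c * xi.
Hypothesis QG : inverse_on_Rplus Q G.
Hypothesis phi_gt : forall s : R, 0 < s < 1 -> s < phi s.
Hypothesis G_phi : forall s u : R, 0 < s < 1 -> 0 < u < c * xi ->
  phi s * G u <= G (s * u).

Definition rhs (B : R -> R) (x : R) : R := \int[mu]_(t in Rplus R) integrand K omega2 B x t.
Definition meaningful (B : R -> R) (x : R) :=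
  mu.-integrable (Rplus R) (EFin \o integrand K omega2 B x).
Definition nonneg (B : R -> R) := forall t : R, 0 <= t -> 0 <= B t.

Lemma K_le_sup (y : R) : K y <= sup (range K).
Proof.
apply: sup_upper_bound; last by exists y.
split; first by exists (K 0); exists 0.
case: K_bounded => A [_ /(_ (A + 1))]; rewrite ltrDl ltr01 => /(_ isT) KA.
exists (A + 1) => _ [z _ <-]; apply: le_trans (KA z I); exact: ler_norm.
Qed.

Lemma supK_ge0 : 0 <= sup (range K).
Proof. by apply: le_trans (K_le_sup 0); exact: ltW. Qed.

Lemma mu2_ge0 (t : R) : 0 <= t -> 0 <= mu2 t.
Proof. by move=> /mu2_gt0/ltW. Qed.

Lemma mass_mu2_ge0 : 0 <= \int[mu]_(t in Rplus R) mu2 t.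
Proof. by apply: Rintegral_ge0 => t /RplusP/mu2_ge0. Qed.

Lemma c_ge1 : 1 <= c.
Proof. by rewrite lerDl mulr_ge0// ?mass_mu2_ge0 ?supK_ge0. Qed.

Lemma omega2_ge0 (t u : R) : 0 <= t -> 0 <= u -> 0 <= omega2 t u.
Proof.
by move=> t0 u0; rewrite -(omega2_0 t0) omega2_incr// in_Rplus.
Qed.

Lemma load_ge0 (B : R -> R) (t : R) : 0 <= t -> 0 <= B t -> 0 <= B t + omega2 t (B t).
Proof. by move=> t0 Bt; rewrite addr_ge0// omega2_ge0. Qed.

Lemma load_le (B : R -> R) (s t : R) : 0 <= t -> 0 <= B t <= s ->
  B t + omega2 t (B t) <= s + mu2 t * s.
Proof.
move=> t0 /andP[B0 Bs]; apply: lerD => //.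
by rewrite (le_trans (omega2_le t0 B0))// ler_wpM2l// mu2_ge0.
Qed.

Lemma kdiff_Rplus_integrable (x : R) : mu.-integrable (Rplus R) (EFin \o kdiff K x).
Proof. exact: (kdiff_integrable K_gt0 K_even K_derivable K_int). Qed.

Lemma kdiff_Rplus_ge0 (x : R) : 0 <= x -> forall t : R, 0 <= t -> 0 <= kdiff K x t.
Proof. by move=> x0 t t0; exact: kdiff_ge0. Qed.

(** The bound uses that the mass of the kernel is at most 1 and that the kernel is
    at most the supremum of [K]; [c] is exactly what results. *)
Lemma rhs_le (B : R -> R) (s x : R) : 0 <= s -> 0 <= x -> meaningful B x ->
  (forall t, 0 <= t -> 0 <= B t <= s) -> rhs B x <= c * s.
Proof.
move=> s0 x0 iB Bs.
apply: (le_trans (weighted_integral_le (kdiff_Rplus_ge0 x0)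
  (fun t _ => kdiff_le K_gt0 x t K_le_sup) (kdiff_Rplus_integrable x) mu2_ge0 mu2_integrable s0 iB _)).
  by move=> t t0; exact: load_le (Bs t t0).
rewrite mulrC ler_wpM2r// /Mconst mulrC lerD2r.
exact: (kdiff_mass_le1 K_gt0 K_even K_derivable K_int).
Qed.

(** Near 0 the kernel vanishes linearly in [x], because [K] is Lipschitz. *)
Lemma rhs_le_linear : exists b : R, 0 <= b /\ forall (B : R -> R) (x : R), 0 <= x ->
  meaningful B x -> (forall t, 0 <= t -> 0 <= B t <= xi) -> rhs B x <= b * x.
Proof.
case: K'_bounded => A [_ /(_ (A + 1))]; rewrite ltrDl ltr01 => /(_ isT) KA.
have KL (y : R) : `|derive1 K y| <= A + 1 by exact: KA.
have L0 : 0 <= A + 1 by exact: le_trans (KL 0).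
exists (xi * (2 * sup (range K) + 2 * (A + 1) * \int[mu]_(t in Rplus R) mu2 t)); split.
  by rewrite mulr_ge0 ?(ltW xi_gt0)// addr_ge0 ?mulr_ge0 ?supK_ge0 ?mass_mu2_ge0.
move=> B x x0 iB Bs.
apply: (le_trans (weighted_integral_le (kdiff_Rplus_ge0 x0)
  (fun t _ => kdiff_le_lipschitz K_even K_derivable t KL x0) (kdiff_Rplus_integrable x) mu2_ge0
  mu2_integrable (ltW xi_gt0) iB _)).
  by move=> t t0; exact: load_le (Bs t t0).
rewrite -[leRHS]mulrA ler_wpM2l ?(ltW xi_gt0)//.
have := kdiff_mass_le K_gt0 K_even K_derivable K_int K_le_sup x0.
move=> h; rewrite [leRHS]mulrDl lerD//.
  by rewrite (le_trans h)// mulrAC.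
by rewrite le_eqVlt; apply/orP; left; apply/eqP; ring.
Qed.

Lemma rhs_ge (B : R -> R) (e r x : R) : 0 <= e -> 0 <= r -> 0 <= x -> meaningful B x ->
  nonneg B -> (forall t, r <= t -> e <= B t) ->
  e * (2 * Num.min x r * K (2 * r)) <= rhs B x.
Proof.
move=> e0 r0 x0 iB B0 Be.
have load0 t : 0 <= t -> 0 <= B t + omega2 t (B t).
  by move=> t0; rewrite load_ge0 ?B0.
have loade t : r <= t -> e <= B t + omega2 t (B t).
  move=> rt; have t0 := le_trans r0 rt.
  by rewrite (le_trans (Be t rt))// lerDl omega2_ge0 ?B0.
apply: le_trans (weighted_integral_ge (kdiff_Rplus_ge0 x0) (kdiff_Rplus_integrable x) r0 iB load0 loade).
by rewrite ler_wpM2l// (kdiff_tail_ge K_gt0 K_even K_derivable K_decr K_int).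
Qed.

Lemma rhs_ge0 (B : R -> R) (x : R) : 0 <= x -> nonneg B -> 0 <= rhs B x.
Proof.
move=> x0 B0; apply: Rintegral_ge0 => t /RplusP t0.
by rewrite mulr_ge0 ?kdiff_Rplus_ge0 ?load_ge0 ?B0.
Qed.

(** Concavity of [omega2] makes the right-hand side a concave operator. *)
Lemma rhs_scale (B1 B2 : R -> R) (s x : R) : 0 <= s <= 1 -> 0 <= x ->
  meaningful B1 x -> meaningful B2 x -> nonneg B1 ->
  (forall t, 0 <= t -> s * B1 t <= B2 t) -> s * rhs B1 x <= rhs B2 x.
Proof.
move=> s01 x0 iB1 iB2 B10 B12; have /andP[s0 _] := s01.
have mD : measurable (Rplus R : set (measurableTypeR R)) by exact: measurable_Rplus.
rewrite /rhs -RintegralZl//.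
have isB1 : mu.-integrable (Rplus R) (EFin \o (fun t => s * integrand K omega2 B1 x t)).
  have := integrableZl mD s iB1.
  by apply: eq_integrable => // t _ /=; rewrite EFinM.
apply: le_Rintegral => // t /RplusP t0.
rewrite /integrand mulrCA ler_wpM2l ?kdiff_Rplus_ge0// mulrDr lerD ?B12//.
have sB0 : 0 <= s * B1 t by rewrite mulr_ge0 ?B10.
rewrite (le_trans (concave_on_scale (omega2_concave t0) (omega2_0 t0) s01 (B10 t t0)))//.
have B2t := B12 t t0.
by apply: omega2_incr; rewrite ?in_Rplus// (le_trans sB0).
Qed.

(** * Uniqueness *)

Lemma frakM_spec (B : R -> R) : frakM R B ->
  [/\ exists s, forall t, 0 <= t -> B t <= s, nonneg B &
   exists r e, [/\ 0 < r, 0 < e & forall t, r <= t -> e <= B t]].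
Proof.
move=> [[A [_ /(_ (A + 1))]]]; rewrite ltrDl ltr01 => /(_ isT) BA B0 [r r0 e0].
split=> //.
  by exists (A + 1) => t /RplusP/BA; apply: le_trans; exact: ler_norm.
exists (r + 1), (inf (B @` `]r, +oo[)); split=> //; first by rewrite addr_gt0.
move=> t rt; apply: inf_lbound.
  exists 0 => _ [u /= + <-]; rewrite in_itv/= andbT => ru.
  by rewrite B0// (le_trans (ltW r0))// ltW.
by exists t => //=; rewrite in_itv/= andbT (lt_le_trans _ rt)// ltrDl.
Qed.

(** The supremum [s] of a solution satisfies [Q s <= c * s], so that [le_xi]
    applies. *)
Lemma solution_le_xi (B : R -> R) : frakM R B -> is_solution K omega2 Q B ->
  forall t, 0 <= t -> 0 <= B t <= xi.
Proof.
move=> /frakM_spec[[s1 Bs1] B0 _] solB.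
pose s := sup (B @` Rplus R).
have supB : has_sup (B @` Rplus R).
  split; first by exists (B 0); exists 0 => //; apply/RplusP.
  by exists s1 => _ [t /RplusP t0 <-]; exact: Bs1.
have Bs t : 0 <= t -> B t <= s.
  by move=> t0; apply: sup_upper_bound => //; exists t => //; apply/RplusP.
have s0 : 0 <= s by rewrite (le_trans (B0 0 _))// Bs.
have cs0 : 0 <= c * s by rewrite mulr_ge0// (le_trans ler01 c_ge1).
suff sxi : s <= xi by move=> t t0; rewrite B0// (le_trans (Bs t t0)).
apply: (le_xi Q_incr QG Q0 Q_convex xi_gt0 c_ge1 Q_xi phi_gt G_phi s0).
rewrite -[leRHS](GK QG)// (Q_le Q_incr QG) ?(G_ge0 QG)//.
apply: ge_sup; first exact: supB.1.
move=> _ [x /RplusP x0 <-]; rewrite -(Q_le Q_incr QG) ?(G_ge0 QG) ?B0// (GK QG)//.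
have [iB ->] := solB x x0; apply: rhs_le => // t t0.
by rewrite B0// Bs.
Qed.

(** One round of improvement: passing from [Q] to [Q^-1] turns a ratio [s] into
    the strictly better ratio [phi s]. *)
Lemma Q_scale_le (u v s : R) : 0 < s < 1 -> 0 <= u <= xi -> 0 <= v ->
  s * Q u <= Q v -> phi s * u <= v.
Proof.
move=> s01 /andP[u0 uxi] v0 suv; have /andP[s0 s1] := s01.
have Qu : 0 <= Q u <= c * xi.
  by rewrite Q_ge0//= -Q_xi (Q_le Q_incr QG)// ltW.
have := G_phi_le Q_incr QG Q0 phi_gt G_phi s01 Qu.
rewrite (QK QG u0) => /le_trans; apply.
rewrite -[leRHS](QK QG v0) (G_le Q_incr QG) ?Q_ge0//.
by rewrite mulr_ge0 ?Q_ge0// ltW.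
Qed.

(** Away from 0 the ratio is controlled by the positive infimum of [B2] and the
    upper bound [xi] of [B1]. Near 0 both solutions may vanish, but there the
    right-hand sides are comparable with [x]: at least [a * x] for [B2] by
    [rhs_ge], at most [b * x] for [B1] by [rhs_le_linear]. *)
Lemma comparable_solutions (B1 B2 : R -> R) :
  frakM R B1 -> is_solution K omega2 Q B1 ->
  frakM R B2 -> is_solution K omega2 Q B2 ->
  exists2 s : R, 0 < s < 1 & forall t, 0 <= t -> s * B1 t <= B2 t.
Proof.
move=> fB1 sB1 fB2 sB2.
have B1xi := solution_le_xi fB1 sB1.
have [_ B20 [r [e [r0 e0 B2e]]]] := frakM_spec fB2.
have [b [b0 rhsb]] := rhs_le_linear.
have K2r := K_gt0 (2 * r); have xi0 := xi_gt0.
pose a := e * (2 * K (2 * r)).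
have a0 : 0 < a by rewrite !mulr_gt0.
have b1 : 0 < b + 1 by lra.
(* [b] may be 0, hence the denominator [b + 1] *)
pose s := Num.min (1 / 2) (Num.min (e / xi) (a / (b + 1))).
have s0 : 0 < s by rewrite !lt_min !divr_gt0.
have s12 : s <= 1 / 2 by rewrite ge_min lexx.
have sxi : s * xi <= e by rewrite -ler_pdivlMr// /s !ge_min lexx !orbT.
have sb : s * b <= a.
  apply: (@le_trans _ _ (s * (b + 1))); first by rewrite ler_pM2l//; lra.
  by rewrite -ler_pdivlMr// /s !ge_min lexx !orbT.
have s01 : 0 < s < 1 by rewrite s0/=; lra.
exists s => // x x0; have /andP[B10 B11] := B1xi x x0.
have [xr|rx] := leP x r; last first.
  by rewrite (le_trans _ (B2e x (ltW rx)))// (le_trans _ sxi)// ler_pM2l.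
apply: (@le_trans _ _ (phi s * B1 x)).
  by rewrite ler_wpM2r// ltW// phi_gt.
apply: Q_scale_le => //; [exact: B1xi|exact: B20|].
have [iB1 QB1] := sB1 x x0; have [iB2 QB2] := sB2 x x0; rewrite QB1 QB2.
apply: (le_trans _ (rhs_ge (ltW e0) (ltW r0) x0 iB2 B20 B2e)).
have -> : Num.min x r = x by apply/min_idPl.
have -> : e * (2 * x * K (2 * r)) = a * x by rewrite /a; ring.
apply: (@le_trans _ _ (s * (b * x))).
  by rewrite ler_pM2l// rhsb.
by rewrite mulrA ler_wpM2r.
Qed.

(** The largest [s <= 1] with [s * B1 <= B2] must be 1, since otherwise [phi s]
    would be a larger admissible ratio. *)
Lemma solution_le (B1 B2 : R -> R) :
  frakM R B1 -> is_solution K omega2 Q B1 ->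
  frakM R B2 -> is_solution K omega2 Q B2 ->
  forall x, 0 <= x -> B1 x <= B2 x.
Proof.
move=> fB1 sB1 fB2 sB2.
have B1xi := solution_le_xi fB1 sB1; have B2xi := solution_le_xi fB2 sB2.
have B10 : nonneg B1 by move=> t /B1xi/andP[].
have B20 : nonneg B2 by move=> t /B2xi/andP[].
have [s0 /andP[s00 s01] B12] := comparable_solutions fB1 sB1 fB2 sB2.
pose A := [set s : R | 0 <= s <= 1 /\ forall t, 0 <= t -> s * B1 t <= B2 t].
have As0 : A s0 by split=> //; rewrite !ltW.
have supA : has_sup A.
  by split; [exists s0|exists 1 => s [/andP[]]].
pose s := sup A.
have ss0 : s0 <= s by exact: sup_upper_bound.
have s1 : s <= 1 by apply: ge_sup; [exists s0|move=> u [/andP[]]].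
have As : forall t, 0 <= t -> s * B1 t <= B2 t.
  move=> t t0; rewrite leNgt; apply/negP => lt.
  have B1t : 0 < B1 t.
    rewrite lt_neqAle B10// andbT; apply/eqP => E.
    by move: lt; rewrite -E mulr0 ltNge B20.
  have : B2 t / B1 t < s by rewrite ltr_pdivrMr.
  move=> /(sup_gt supA.1)[u [_ /(_ t t0) uB]]; rewrite ltr_pdivrMr// ltNge.
  by rewrite uB.
suff sE : s = 1 by move=> x x0; have := As x x0; rewrite sE mul1r.
apply/eqP; rewrite eq_le s1/= leNgt; apply/negP => slt1.
have s_01 : 0 < s < 1 by rewrite slt1 (lt_le_trans s00).
have sphi := phi_gt s_01.
have phiB x : 0 <= x -> phi s * B1 x <= B2 x.
  move=> x0; apply: Q_scale_le => //; [exact: B1xi|exact: B20|].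
  have [iB1 ->] := sB1 x x0; have [iB2 ->] := sB2 x x0.
  by apply: rhs_scale => //; rewrite !ltW ?(lt_le_trans s00).
pose u := Num.min 1 (phi s).
have su : s < u by rewrite lt_min slt1.
have : A u.
  split; first by rewrite (le_trans _ (ltW su)) ?(le_trans (ltW s00))//= ge_min lexx.
  move=> x x0; apply: le_trans (phiB x x0).
  by rewrite ler_wpM2r ?B10// ge_min lexx orbT.
by move=> /(sup_upper_bound supA); rewrite leNgt su.
Qed.

(** * Existence *)

Lemma rhs_measurable (B : R -> R) : nonneg B -> measurable_fun (Rplus R) B ->
  measurable_fun (Rplus R) (rhs B).
Proof.
move=> B0 mB.
have mK (g : measurableTypeR R * measurableTypeR R -> R) :
    measurable_fun setT g -> measurable_fun setT (K \o g).
  by move=> mg; apply: (measurableT_comp (K_measurable K_derivable (D := setT))).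
apply: (@kernel_operator_measurable _ (kdiff K)).
- by apply: measurable_funB; apply: mK; [apply: measurable_funB|apply: measurable_funD].
- by move=> x t; exact: kdiff_ge0.
- by move=> t t0; rewrite load_ge0 ?B0.
- apply: measurable_funD => //.
  exact: (superposition_measurable omega2_0 omega2_continuous omega2_incr omega2_concave).
Qed.

Definition step (B : R -> R) (x : R) : R := G (rhs B x).

(** The measurable functions between the step function equal to [e] on [1, +oo[ and
    to 0 elsewhere, and the constant [xi]. *)
Definition order_interval (e : R) (B : R -> R) :=
  [/\ measurable_fun (Rplus R) B, (forall t, 0 <= t -> 0 <= B t <= xi) &
   (forall t, 1 <= t -> e <= B t)].

Lemma order_interval_meaningful (e : R) (B : R -> R) (x : R) : 0 <= x ->
  order_interval e B -> meaningful B x.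
Proof.
move=> x0 [mB Bxi _].
apply: (weighted_integrable (kdiff_Rplus_ge0 x0)
  (fun t _ => kdiff_le K_gt0 x t K_le_sup) (kdiff_Rplus_integrable x) mu2_ge0 mu2_integrable (ltW xi_gt0)).
- apply: measurable_funD => //.
  apply: (superposition_measurable omega2_0 omega2_continuous omega2_incr omega2_concave) => //.
  by move=> t /Bxi/andP[].
- move=> t t0; rewrite load_le ?Bxi// andbT load_ge0//.
  by have /andP[] := Bxi t t0.
Qed.

(** On [1, +oo[ the kernel retains a mass of at least [2 * K 2] over [1, +oo[, so
    the lower bound [e] survives as soon as [Q e] is below that fraction
    of [e]. *)
Lemma step_order_interval (e : R) (B : R -> R) : 0 <= e -> Q e <= 2 * K 2 * e ->
  order_interval e B -> order_interval e (step B).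
Proof.
move=> e0 Qe BI; have [mB Bxi Be] := BI.
have B0 : nonneg B by move=> t /Bxi/andP[].
have rhs0 x : 0 <= x -> 0 <= rhs B x by move=> x0; exact: rhs_ge0.
split.
- have mG : measurable_fun (Rplus R) G.
    apply: nondecreasing_on_measurable => u v; rewrite !in_Rplus => u0 v0.
    by rewrite (G_le Q_incr QG).
  apply: (measurable_comp (F := Rplus R)) mG _.
  + exact: measurable_Rplus.
  + by move=> _ [x /RplusP x0 <-]; apply/RplusP; exact: rhs0.
  + exact: rhs_measurable.
- move=> x x0; rewrite (G_ge0 QG) ?rhs0//= -(Q_le Q_incr QG) ?(G_ge0 QG) ?rhs0 ?(ltW xi_gt0)//.
  rewrite (GK QG) ?rhs0// Q_xi; apply: rhs_le => //; first exact: ltW.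
  exact: (order_interval_meaningful x0 BI).
- move=> x x1; have x0 : 0 <= x by exact: le_trans x1.
  rewrite -(Q_le Q_incr QG) ?(G_ge0 QG) ?rhs0// (GK QG) ?rhs0//.
  have iB := order_interval_meaningful x0 BI.
  apply: (le_trans Qe); apply: le_trans (rhs_ge e0 ler01 x0 iB B0 Be).
  have -> : Num.min x 1 = 1 by apply/min_idPr.
  by rewrite !mulr1 mulrC.
Qed.

Lemma step_mono (e : R) (B1 B2 : R -> R) : order_interval e B1 -> order_interval e B2 ->
  (forall t, 0 <= t -> B1 t <= B2 t) -> forall x, 0 <= x -> step B1 x <= step B2 x.
Proof.
move=> I1 I2 B12 x x0; have [_ B1xi _] := I1; have [_ B2xi _] := I2.
have B10 : nonneg B1 by move=> t /B1xi/andP[].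
have B20 : nonneg B2 by move=> t /B2xi/andP[].
rewrite (G_le Q_incr QG) ?rhs_ge0//.
have := @rhs_scale B1 B2 1 x; rewrite mul1r; apply=> //.
- by rewrite ler01 lexx.
- exact: (order_interval_meaningful x0 I1).
- exact: (order_interval_meaningful x0 I2).
- by move=> t t0; rewrite mul1r B12.
Qed.

Lemma rhs_cvg (e : R) (B_ : nat -> R -> R) (B : R -> R) (x : R) : 0 <= x ->
  (forall n, order_interval e (B_ n)) -> order_interval e B ->
  (forall t, 0 <= t -> B_ ^~ t @ \oo --> B t) ->
  (fun n => rhs (B_ n) x) @ \oo --> rhs B x.
Proof.
move=> x0 BnI BI BnB.
have mD : measurable (Rplus R : set (measurableTypeR R)) by exact: measurable_Rplus.
have iBn n := order_interval_meaningful x0 (BnI n).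
have iB := order_interval_meaningful x0 BI.
(* all the integrands are dominated by that of the constant [xi] *)
have topI : order_interval 0 (cst xi).
  by split=> [|t _|t _]; [exact: measurable_cst|rewrite lexx ltW|exact: ltW].
have itop := order_interval_meaningful x0 topI.
have cvg_integrand t : Rplus R t ->
    (fun n => (integrand K omega2 (B_ n) x t)%:E) @ \oo --> (integrand K omega2 B x t)%:E.
  move=> /RplusP t0; apply: cvg_EFin; first exact: filterE.
  have [_ /(_ t t0)/andP[Bt0 _] _] := BI.
  apply: cvgMl_tmp; apply: cvgD; first exact: BnB.
  apply: superposition_cvg => //; last exact: BnB.
  by move=> n; have [_ /(_ t t0)/andP[]] := BnI n.
have le_top t n : Rplus R t ->
    (`|(integrand K omega2 (B_ n) x t)%:E| <= (integrand K omega2 (cst xi) x t)%:E)%E.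
  move=> /RplusP t0; have [_ /(_ t t0)/andP[Bt0 Btxi] _] := BnI n.
  rewrite /= lee_fin ger0_norm; last by rewrite mulr_ge0 ?kdiff_Rplus_ge0 ?load_ge0.
  rewrite ler_wpM2l ?kdiff_Rplus_ge0// lerD//.
  by apply: omega2_incr; rewrite ?in_Rplus// ltW.
have [_ _ cv] := @dominated_convergence _ _ _ mu (Rplus R) mD
  (fun n => EFin \o integrand K omega2 (B_ n) x) (EFin \o integrand K omega2 B x)
  (EFin \o integrand K omega2 (cst xi) x) (fun n => measurable_int mu (iBn n))
  (measurable_int mu iB)
  (aeW mu cvg_integrand) itop (aeW mu le_top).
apply: fine_cvg.
rewrite /rhs /Rintegral fineK; last exact: integrable_fin_num iB.
exact: cv.
Qed.

(** The iterates of [step] from [xi] decrease and stay in the order interval, so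
    they converge to a function of the order interval, which is a solution by
    dominated convergence and continuity of [Q]. *)
Lemma solution_exists : exists B, frakM R B /\ is_solution K omega2 Q B.
Proof.
have dK : 0 < 2 * K 2 by rewrite mulr_gt0.
have [e /andP[e0 exi] Qe] :=
  superlinear_at0 Q_incr QG Q0 xi_gt0 c_ge1 Q_xi phi_gt G_phi dK.
pose B_ n := iter n step (cst xi).
have BI n : order_interval e (B_ n).
  elim: n => [|n IH]; last exact: step_order_interval (ltW e0) Qe IH.
  split=> //; first exact: measurable_cst.
  by move=> t _; rewrite /= lexx ltW.
have Bdecr n t : 0 <= t -> B_ n.+1 t <= B_ n t.
  elim: n t => [t t0|n IH t t0]; last exact: (step_mono (BI n.+1) (BI n)).
  by have [_ /(_ t t0)/andP[]] := BI 1%N.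
have Bni t : 0 <= t -> nonincreasing_seq (B_ ^~ t).
  by move=> t0; apply/nonincreasing_seqP => n; exact: Bdecr.
have Blb t : 0 <= t -> has_lbound (range (B_ ^~ t)).
  move=> t0; exists 0 => _ [n _ <-].
  by have [_ /(_ t t0)/andP[]] := BI n.
pose B t := limn (B_ ^~ t).
have BnB t : 0 <= t -> B_ ^~ t @ \oo --> B t.
  by move=> t0; apply: nonincreasing_is_cvgn; [exact: Bni|exact: Blb].
have BBI : order_interval e B.
  split.
  - apply: (measurable_fun_cvg (h := B_)); first by move=> n; have [] := BI n.
    by move=> t /RplusP; exact: BnB.
  - move=> t t0; apply/andP; split.
    + apply: (limr_ge (BnB t t0)); apply: nearW => n.
      by have [_ /(_ t t0)/andP[]] := BI n.
    + apply: (limr_le (BnB t t0)); apply: nearW => n.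
      by have [_ /(_ t t0)/andP[]] := BI n.
  - move=> t t1; apply: limr_ge; first exact: BnB (le_trans ler01 t1).
    by apply: nearW => n; have [_ _ /(_ t t1)] := BI n.
have [_ Bxi Be] := BBI.
exists B; split.
  split.
  - exists xi; split; first exact: num_real.
    move=> y xiy t /RplusP/Bxi/andP[Bt0 Btxi].
    by rewrite /= ger0_norm// (le_trans Btxi)// ltW.
  - by move=> t /Bxi/andP[].
  - exists 1 => //; apply: (lt_le_trans e0); apply: lb_le_inf.
      by exists (B 2); exists 2 => //=; rewrite in_itv/= andbT ltr1n.
    by move=> _ [t /= + <-]; rewrite in_itv/= andbT => /ltW/Be.
move=> x x0; split; first exact: (order_interval_meaningful x0 BBI).
have QB : (fun n => Q (B_ n.+1 x)) @ \oo --> Q (B x).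
  apply: (within_continuous_cvg (g := fun n => B_ n.+1 x) Q_continuous).
  - by apply/RplusP; have /andP[] := Bxi x x0.
  - by apply: filterE => n; apply/RplusP; have [_ /(_ x x0)/andP[]] := BI n.+1.
  - by rewrite (cvg_shiftS (B_ ^~ x)); exact: BnB.
have rhsB := rhs_cvg x0 BI BBI BnB.
have QBE : (fun n => Q (B_ n.+1 x)) = (fun n => rhs (B_ n) x).
  apply/funext => n; rewrite (GK QG)// rhs_ge0// => t t0.
  by have [_ /(_ t t0)/andP[]] := BI n.
rewrite QBE in QB; exact: (cvg_unique _ QB rhsB).
Qed.

Lemma exists_unique_solution : exists B : R -> R,
  [/\ frakM R B, is_solution K omega2 Q B &
   forall B' : R -> R, frakM R B' -> is_solution K omega2 Q B' ->
     forall x : R, 0 <= x -> B' x = B x].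
Proof.
have [B [fB sB]] := solution_exists; exists B; split=> // B' fB' sB' x x0.
by apply: le_anti; rewrite !solution_le.
Qed.

End equation.

Theorem theorem3 (R : realType)
  (K : R -> R) (omega2 : R -> R -> R) (Q : R -> R)
  (mu2 : R -> R) (xi : R) (G : R -> R) (phi : R -> R)
  (Q_Rplus : forall u : R, 0 <= u -> 0 <= Q u)
  (* 1) *)
  (K_gt0 : forall x : R, 0 < K x)
  (K_even : forall t : R, 0 <= t -> K (- t) = K t)
  (K_derivable : forall x : R, derivable K x 1)
  (K'_continuous : continuous (derive1 K))
  (K_bounded : [bounded (K x : R^o) | x in [set: R]])
  (K'_bounded : [bounded (derive1 K x : R^o) | x in [set: R]])
  (* 2) *)
  (K_decr : nonincreasing_on (Rplus R) K)
  (K_int : (\int[lebesgue_measure]_(t in Rplus R) (K t)%:E = (2^-1)%:E)%E)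
  (* 3) *)
  (xK_int : (\int[lebesgue_measure]_(x in Rplus R) (x * K x)%:E < +oo)%E)
  (* 0) *)
  (Q0 : Q 0 = 0)
  (omega2_0 : forall t : R, 0 <= t -> omega2 t 0 = 0)
  (* b1) *)
  (omega2_continuous :
    {within Rplus R `*` Rplus R, continuous (fun p : R * R => omega2 p.1 p.2)})
  (omega2_incr : forall t : R, 0 <= t -> nondecreasing_on (Rplus R) (omega2 t))
  (omega2_concave : forall t : R, 0 <= t -> concave_on (Rplus R) (omega2 t))
  (* b2) *)
  (mu2_gt0 : forall t : R, 0 <= t -> 0 < mu2 t)
  (mu2_integrable : lebesgue_measure.-integrable (Rplus R) (EFin \o mu2))
  (mu2_lim : mu2 t @[t --> +oo] --> 0)
  (omega2_le : forall t u : R, 0 <= t -> 0 <= u -> omega2 t u <= mu2 t * u)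
  (* I) *)
  (Q_continuous : {within Rplus R, continuous Q})
  (Q_incr : nondecreasing_on (Rplus R) Q)
  (* II) *)
  (Q_convex : convex_on (Rplus R) Q)
  (xi_gt0 : 0 < xi)
  (Q_xi : Q xi = (1 + Mconst K mu2) * xi)
  (* III) *)
  (G_inverse : inverse_on_Rplus Q G)
  (phi_unit : forall s : R, s \in unit_itv R -> phi s \in unit_itv R)
  (phi_continuous : {within unit_itv R, continuous phi})
  (phi_incr : nondecreasing_on (unit_itv R) phi)
  (phi_concave : concave_on (unit_itv R) phi)
  (* concavity is not degenerate: phi is not the identity *)
  (phi_neq_id : exists2 s : R, s \in unit_itv R & phi s != s)
  (phi0 : phi 0 = 0)
  (phi1 : phi 1 = 1)
  (G_phi : forall s u : R, 0 < s < 1 -> 0 < u < (1 + Mconst K mu2) * xi ->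
    phi s * G u <= G (s * u)) :
  exists B : R -> R,
    [/\ frakM R B,
        is_solution K omega2 Q B &
        forall B' : R -> R, frakM R B' -> is_solution K omega2 Q B' ->
          forall x : R, 0 <= x -> B' x = B x].
Proof.
have phi_gt := concave_unit_gt phi_concave phi0 phi1 phi_neq_id.
exact: (exists_unique_solution K_gt0 K_even K_derivable K_bounded K'_bounded
  K_decr K_int Q_Rplus Q0 omega2_0 omega2_continuous omega2_incr omega2_concave
  mu2_gt0 mu2_integrable omega2_le Q_continuous Q_incr Q_convex xi_gt0 Q_xi
  G_inverse phi_gt G_phi).
Qed.
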